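(* Let $R$ be a ring with proper involution $*$, let $m\ge 1$ be an integer and let $a\in R^{\overline{D}}$. Then $a\in R^{\overline{W}_m}$ and $$a^{\overline{W}_m}=(a^{\overline{D}})^{m+1}a^m.$$
   Context: Rings are associative with identity and $\mathbb{N}$ is the set of positive integers. An involution $*$ on $R$ satisfies $(x+y)^*=x^*+y^*$, $(xy)^*=y^*x^*$, $(x^* )^*=x$; it is proper if $x^*x=0$ implies $x=0$. An element $a\in R$ has an $m$-weak group inverse if there exist $x\in R$ and $k\in\mathbb{N}$ with $ax^2=x$, $xa^{k+1}=a^k$ and $(a^k)^*a^{m+1}x=(a^k)^*a^m$; such an $x$ is unique if it exists and is denoted $a^{\overline{W}_m}$. $R^{\overline{W}_m}$ is the set of elements of $R$ having an $m$-weak group inverse. An element $a\in R$ has a core-EP inverse if there exist $x\in R$ and $k\in\mathbb{N}$ with $ax^2=x$, $(ax)^*=ax$, $a^k=xa^{k+1}$; such an $x$ is unique if it exists and is denoted $a^{\overline{D}}$. $R^{\overline{D}}$ is the set of core-EP invertible elements of $R$. *)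

(* Defs.v *)
From mathcomp Require Import all_boot all_algebra.
From mathcomp Require Import boolp classical_sets.

Set Implicit Arguments.
Unset Strict Implicit.
Unset Printing Implicit Defensive.

Import GRing.Theory.
Local Open Scope ring_scope.
Local Open Scope classical_set_scope.

(* pzRingType: associative, unital, not necessarily commutative; the zero
   ring is allowed. *)
Record involution (R : pzRingType) (star : R -> R) : Prop := Involution {
  starD : {morph star : x y / x + y};
  starM : {morph star : x y / x * y >-> y * x};
  starK : involutive star
}.

Definition proper_involution (R : pzRingType) (star : R -> R) : Prop :=
  involution star /\ (forall x : R, star x * x = 0 -> x = 0).

Definition is_m_weak_group_inverse (R : pzRingType) (star : R -> R) (m : nat)
    (a x : R) : Prop :=
  exists k : nat, [/\ (0 < k)%N,
    a * x ^+ 2 = x,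
    x * a ^+ k.+1 = a ^+ k &
    star (a ^+ k) * a ^+ m.+1 * x = star (a ^+ k) * a ^+ m].

Definition is_core_EP_inverse (R : pzRingType) (star : R -> R)
    (a x : R) : Prop :=
  exists k : nat, [/\ (0 < k)%N,
    a * x ^+ 2 = x,
    star (a * x) = a * x &
    a ^+ k = x * a ^+ k.+1].

Definition m_weak_group_invertible (R : pzRingType) (star : R -> R) (m : nat) :
    set R :=
  [set a | exists x, is_m_weak_group_inverse star m a x].

Definition core_EP_invertible (R : pzRingType) (star : R -> R) : set R :=
  [set a | exists x, is_core_EP_inverse star a x].

(* [xget 0 P] is an element of P when there is one, and 0 otherwise. For a
   proper involution both inverses are unique when they exist, so the values
   below are then the inverses; 0 is a junk value off the invertible elements. *)
Definition m_weak_group_inverse (R : pzRingType) (star : R -> R) (m : nat)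
    (a : R) : R :=
  xget 0 [set x | is_m_weak_group_inverse star m a x].

Definition core_EP_inverse (R : pzRingType) (star : R -> R) (a : R) : R :=
  xget 0 [set x | is_core_EP_inverse star a x].

(* Main.v *)
Require Import Defs.
From mathcomp Require Import all_boot all_algebra.
From mathcomp Require Import boolp classical_sets.

Set Implicit Arguments.
Unset Strict Implicit.
Unset Printing Implicit Defensive.

Import GRing.Theory.
Local Open Scope ring_scope.
Local Open Scope classical_set_scope.

(* Let d be a core-EP inverse of a.  The identities a^n d^(n+1) = d and
   d^n a^(k+n) = a^k reduce the three defining equations of the m-weak group
   inverse for d^(m+1) a^m to direct computations.  Conversely, if x and y are
   two m-weak group inverses with a common exponent k, then x - y is a right
   multiple of a^k, so z = a^(m+1) (x - y) satisfies z^* z = 0; properness gives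
   z = 0, and multiplying by x^(m+1) on the left gives x = y. *)

Lemma mulX_exprS (R : pzRingType) (a x : R) (n : nat) :
  a * x ^+ 2 = x -> a ^+ n * x ^+ n.+1 = x.
Proof.
move=> axx; elim: n => [|n IHn]; first by rewrite mul1r.
have axxn : a * x ^+ n.+2 = x ^+ n.+1.
  by rewrite -[n.+2]/(2 + n)%N exprD mulrA axx -exprS.
by rewrite exprSr -mulrA axxn.
Qed.

Lemma exprM_expr_add (R : pzRingType) (a x : R) (k n : nat) :
  x * a ^+ k.+1 = a ^+ k -> x ^+ n * a ^+ (k + n) = a ^+ k.
Proof.
move=> xak; elim: n => [|n IHn]; first by rewrite mul1r addn0.
by rewrite exprSr addnS -addSn exprD -mulrA (mulrA x) xak -exprD.
Qed.

(** Exponents can be raised, so inverses with exponents [k] and [l] can be compared at [k + l]. *)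
Lemma m_weak_group_inverse_exprD (R : pzRingType) (star : R -> R)
    (m k j : nat) (a x : R) : involution star ->
  x * a ^+ k.+1 = a ^+ k ->
  star (a ^+ k) * a ^+ m.+1 * x = star (a ^+ k) * a ^+ m ->
  x * a ^+ (k + j).+1 = a ^+ (k + j) /\
  star (a ^+ (k + j)) * a ^+ m.+1 * x = star (a ^+ (k + j)) * a ^+ m.
Proof.
move=> star_inv xak sak; split; first by rewrite -addSn exprD mulrA xak -exprD.
by rewrite exprD (starM star_inv) -!mulrA; congr (_ * _); rewrite mulrA.
Qed.

Lemma m_weak_group_inverse_uniq (R : pzRingType) (star : R -> R) (m : nat)
    (a x y : R) : proper_involution star ->
  is_m_weak_group_inverse star m a x -> is_m_weak_group_inverse star m a y ->
  x = y.
Proof.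
move=> [star_inv star_proper] [k [_ axx xak sx]] [l [_ ayy yal sy]].
have [xan sxn] := m_weak_group_inverse_exprD l star_inv xak sx.
have [_ syn] := m_weak_group_inverse_exprD k star_inv yal sy.
rewrite [(l + k)%N]addnC in syn; set n := (k + l)%N in xan sxn syn.
pose w := x ^+ n.+1 - y ^+ n.+1.
have xyE : x - y = a ^+ n * w by rewrite mulrBr !mulX_exprS.
have z0 : a ^+ m.+1 * (x - y) = 0.
  (* The left factor [a ^+ n] puts [star (a ^+ n)] into [star z], and [star (a ^+ n) * a ^+ m.+1]
     takes the same value on [x] and [y]. *)
  have zE : a ^+ m.+1 * (x - y) = a ^+ n * (a ^+ m.+1 * w).
    by rewrite xyE !mulrA -!exprD addnC.
  apply: star_proper; rewrite {1}zE (starM star_inv) -mulrA.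
  by rewrite (mulrA (star (a ^+ n))) mulrBr sxn syn subrr mulr0.
apply/eqP; rewrite -subr_eq0 xyE -(exprM_expr_add m.+1 xan) addnC exprD.
by rewrite -!mulrA -xyE z0 mulr0.
Qed.

Lemma core_EP_m_weak_group_inverse (R : pzRingType) (star : R -> R) (m : nat)
    (a d : R) : involution star ->
  is_core_EP_inverse star a d ->
  is_m_weak_group_inverse star m a (d ^+ m.+1 * a ^+ m).
Proof.
move=> star_inv [k [k_gt0 add sad /esym dak]]; exists k; split => //.
(* The inner [a ^+ m * d ^+ m.+1] collapses to [d], so the square is [d ^+ m.+2 * a ^+ m]. *)
- rewrite expr2 -mulrA (mulrA (a ^+ m)) mulX_exprS // !mulrA -[_ * d]mulrA.
  by rewrite -exprSr -[m.+2]/(2 + m)%N exprD mulrA add -exprS.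
- by rewrite -mulrA -exprD addnC addSnnS exprM_expr_add.
(* [a * d] is self-adjoint and fixes [a ^+ k] on the left, so [star (a ^+ k)] absorbs it on the
   right. *)
- have adak : a * d * a ^+ k = a ^+ k.
    by rewrite -dak !mulrA -(mulrA a) -expr2 add.
  have -> : star (a ^+ k) * a ^+ m.+1 * (d ^+ m.+1 * a ^+ m) =
            star (a ^+ k) * (a * d) * a ^+ m.
    by rewrite exprS -!mulrA (mulrA (a ^+ m)) mulX_exprS.
  by rewrite -{1}sad -(starM star_inv) adak.
Qed.

Theorem theorem4p1 (R : pzRingType) (star : R -> R)
  (hstar : proper_involution star) (m : nat) (hm : (1 <= m)%N)
  (a : R) (ha : core_EP_invertible star a) :
  m_weak_group_invertible star m a /\
  m_weak_group_inverse star m a = core_EP_inverse star a ^+ m.+1 * a ^+ m.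
Proof.
(* By [ha] the set is nonempty, so [xget] returns a genuine inverse and not the default 0. *)
have dP : is_core_EP_inverse star a (core_EP_inverse star a).
  by case: ha => d da; exact: (xgetI 0 da).
have xP := core_EP_m_weak_group_inverse m hstar.1 dP.
split; first by exists (core_EP_inverse star a ^+ m.+1 * a ^+ m).
exact: m_weak_group_inverse_uniq hstar (xgetI 0 xP) xP.
Qed.
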